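(* For every $n\ge 5$, $$p_2^3-\frac{n(n-1)}{(n-2)^2}p_3^2=\frac{n+3}{n(n-2)}T_n+\frac{1}{n(n-2)(n-4)}U_n+\frac{1}{8n(n-2)^2}R_n,$$ and all three coefficients $\frac{n+3}{n(n-2)}$, $\frac{1}{n(n-2)(n-4)}$, $\frac{1}{8n(n-2)^2}$ are positive.
   Context: Let $x_1,\dots,x_n$ be indeterminates, $\bar x=\frac1n\sum_i x_i$, $z_i=x_i-\bar x$, $p_r=\sum_{i=1}^n z_i^r$. With $\sum^*$ denoting summation over ordered tuples of pairwise distinct indices in $\{1,\dots,n\}$ (empty sums are $0$), define $$T_n=\sum_{1\le i<j<k\le n}(z_i-z_j)^2(z_j-z_k)^2(z_k-z_i)^2,$$ $$U_n=\sum_{i,j,k,l,m}^{*}(z_i-z_j)^2(z_j-z_k)^2(z_l-z_m)^2,$$ $$R_n=\sum_{i,j,k,l,m,s}^{*}(z_i-z_j)^2(z_k-z_l)^2(z_m-z_s)^2.$$ *)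

(* Defs.v *)
From HB Require Import structures.
From mathcomp Require Import all_boot all_order all_algebra.
From mathcomp Require Import mpoly.

Set Implicit Arguments.
Unset Strict Implicit.
Unset Printing Implicit Defensive.

Import Order.TTheory GRing.Theory Num.Theory.
Local Open Scope ring_scope.

(* The index set {1, .., n} is rendered as 'I_n, and x_i as the indeterminate
   'X_i of {mpoly F[n]}. *)

Definition xbar (F : fieldType) (n : nat) : {mpoly F[n]} :=
  n%:R^-1 *: \sum_(i < n) 'X_i.

Definition z (F : fieldType) (n : nat) (i : 'I_n) : {mpoly F[n]} :=
  'X_i - xbar F n.

Definition psum (F : fieldType) (n r : nat) : {mpoly F[n]} :=
  \sum_(i < n) z F i ^+ r.

Definition sqdiff (F : fieldType) (n : nat) (i j : 'I_n) : {mpoly F[n]} :=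
  (z F i - z F j) ^+ 2.

Definition Tsum (F : fieldType) (n : nat) : {mpoly F[n]} :=
  \sum_(i < n) \sum_(j < n | (i < j)%N) \sum_(k < n | (j < k)%N)
    sqdiff F i j * sqdiff F j k * sqdiff F k i.

Definition Usum (F : fieldType) (n : nat) : {mpoly F[n]} :=
  \sum_(i < n) \sum_(j < n) \sum_(k < n) \sum_(l < n)
    \sum_(m < n | uniq [:: i; j; k; l; m])
      sqdiff F i j * sqdiff F j k * sqdiff F l m.

Definition Rsum (F : fieldType) (n : nat) : {mpoly F[n]} :=
  \sum_(i < n) \sum_(j < n) \sum_(k < n) \sum_(l < n) \sum_(m < n)
    \sum_(s < n | uniq [:: i; j; k; l; m; s])
      sqdiff F i j * sqdiff F k l * sqdiff F m s.

(* Main.v *)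
(* Expanding the products of squared differences turns [6 * T_n], [U_n] and
   [R_n] into combinations of sums of monomials over tuples of pairwise distinct
   indices.  Eliminating one index at a time expresses these sums through the
   power sums; as [p_1 = 0] only [p_2^3], [p_3^2], [p_2 p_4] and [p_6] survive,
   and the identity is checked on their coefficients. *)

Require Import Defs.
From HB Require Import structures.
From mathcomp Require Import all_boot all_order all_algebra.
From mathcomp Require Import mpoly zify ring.

Set Implicit Arguments.
Unset Strict Implicit.
Unset Printing Implicit Defensive.

Import Order.TTheory GRing.Theory Num.Theory.
Local Open Scope ring_scope.

(** * Monomial sums over pairwise distinct indices, and their reduction to power sums *)

Section DistinctSums.

Variables (A : comNzRingType) (n : nat) (y : 'I_n -> A).

(* The sum of f v over the k-tuples v such that rev v ++ l is duplicate-free. *)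
Fixpoint distsum (k : nat) (l : seq 'I_n) (f : seq 'I_n -> A) : A :=
  if k is k'.+1 then \sum_i distsum k' (i :: l) (fun v => f (i :: v))
  else (uniq l)%:R * f [::].

Fixpoint monom (a : seq nat) (v : seq 'I_n) : A :=
  match a, v with
  | e :: a', i :: v' => y i ^+ e * monom a' v'
  | _, _ => 1
  end.

(** For [l = [::]] this is the augmented monomial symmetric function with exponents [a]. The list
    [l] of forbidden indices is what inductions on [a] extend. *)
Definition mdsum (a : seq nat) (l : seq 'I_n) : A :=
  distsum (size a) l (monom a).

Definition pows (r : nat) : A := \sum_i y i ^+ r.

Lemma eq_distsum k l (f g : seq 'I_n -> A) :
  f =1 g -> distsum k l f = distsum k l g.
Proof.
elim: k l f g => [|k IHk] l f g fg /=; first by rewrite fg.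
by apply: eq_bigr => i _; apply: IHk => v.
Qed.

Lemma distsum_sum (T : Type) k l (r : seq T) (c : T -> A) f :
  distsum k l (fun v => \sum_(t <- r) c t * f t v) =
  \sum_(t <- r) c t * distsum k l (f t).
Proof.
elim: k l f => [|k IHk] l f /=.
  by rewrite big_distrr; apply: eq_bigr => t _ /=; rewrite mulrCA.
under eq_bigr => i _ do rewrite (IHk _ (fun t v => f t (i :: v))).
by rewrite exchange_big /=; apply: eq_bigr => t _; rewrite big_distrr.
Qed.

Lemma mdsum_cons e a l :
  mdsum (e :: a) l = \sum_i y i ^+ e * mdsum a (i :: l).
Proof.
rewrite /mdsum /=; apply: eq_bigr => i _.
(* A one-term sum turns linearity into extraction of the constant factor [y i ^+ e]. *)
have := distsum_sum (size a) (i :: l) [:: tt] (fun=> y i ^+ e) (fun=> monom a).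
by rewrite big_seq1 => <-; apply: eq_distsum => v; rewrite big_seq1.
Qed.

Lemma perm_mdsumr a l1 l2 : perm_eq l1 l2 -> mdsum a l1 = mdsum a l2.
Proof.
elim: a l1 l2 => [|e a IHa] l1 l2 l12; first by rewrite /mdsum /= (perm_uniq l12).
rewrite !mdsum_cons; apply: eq_bigr => i _; congr (_ * _).
by apply: IHa; rewrite perm_cons.
Qed.

Lemma mdsum_swap e1 e2 a l : mdsum [:: e1, e2 & a] l = mdsum [:: e2, e1 & a] l.
Proof.
rewrite (mdsum_cons e1) (mdsum_cons e2).
under eq_bigr => i _ do rewrite mdsum_cons big_distrr.
under [RHS]eq_bigr => i _ do rewrite mdsum_cons big_distrr.
rewrite exchange_big; apply: eq_bigr => i _; apply: eq_bigr => j _ /=.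
rewrite mulrCA; congr (_ * (_ * _)); apply: perm_mdsumr.
by apply/permPl; exact: (perm_catCA [:: _] [:: _]).
Qed.

Lemma mdsum_rcons_head e a l : mdsum (e :: a) l = mdsum (rcons a e) l.
Proof.
elim: a l => // b a IHa l.
by rewrite mdsum_swap /= !(mdsum_cons b); apply: eq_bigr => i _; rewrite IHa.
Qed.

Lemma mdsum_catC a b l : mdsum (a ++ b) l = mdsum (b ++ a) l.
Proof.
elim: a b => [|e a IHa] b; first by rewrite cats0.
by rewrite cat_cons mdsum_rcons_head rcons_cat IHa cat_rcons.
Qed.

(** Swapping two leading exponents is an exchange of summations; iterated, it yields cyclic shifts,
    which bring the head of [a] to the front of [b]. *)
Lemma perm_mdsum a b l : perm_eq a b -> mdsum a l = mdsum b l.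
Proof.
elim: a b l => [|e a IHa] b l; first by rewrite perm_sym => /perm_nilP->.
move=> ab; have eb : e \in b by rewrite -(perm_mem ab) mem_head.
case/splitPr: b / eb ab => b1 b2.
rewrite perm_sym -cat1s perm_catCA perm_cons perm_sym => ab.
rewrite mdsum_catC /= mdsum_cons mdsum_cons; apply: eq_bigr => i _.
by rewrite mdsum_catC (IHa _ _ ab).
Qed.

(** These lists encode the collisions: an index of exponent [e] coinciding with one of the indices
    of [a] adds [e] to that entry. *)
Fixpoint addone (e : nat) (a : seq nat) : seq (seq nat) :=
  if a is b :: a' then (b + e :: a')%N :: [seq b :: c | c <- addone e a']
  else [::].

(** Let the last index run freely, which gives [pows e], then remove its values in [l] and its
    collisions with the indices of [a]. *)
Lemma mdsum_rcons a e l :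
  mdsum (rcons a e) l = mdsum a l * (pows e - \sum_(j <- l) y j ^+ e)
                        - \sum_(c <- addone e a) mdsum c l.
Proof.
elim: a l => [|b a IHa] l.
  rewrite mdsum_cons big_nil subr0 /mdsum /= mulr1.
  (* If [l] has a repetition, both sides vanish; otherwise the sum over the list [l] is a sum over
     its members, and the free sum splits by membership. *)
  have [ul|_] /= := boolP (uniq l); last first.
    by rewrite mul0r big1 // => i _; rewrite andbF mul0r mulr0.
  rewrite mul1r /pows (bigID (mem l)) /=.
  rewrite big1 ?add0r; last by move=> i ->; rewrite mul0r mulr0.
  rewrite [X in _ = X - _](bigID (mem l)) /= (big_uniq _ ul) /=.
  rewrite [X in _ = X - _]addrC addrK.
  by apply: eq_bigr => i ->; rewrite !mulr1.
rewrite rcons_cons mdsum_cons /= big_cons big_map.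
under eq_bigr => i _ do rewrite IHa big_cons.
rewrite !mdsum_cons big_distrl opprD addrA /= -!sumrB.
under [X in _ - X]eq_bigr => c _ do rewrite mdsum_cons.
rewrite [X in _ - X]exchange_big -sumrB; apply: eq_bigr => i _ /=.
(* The induction hypothesis at [i :: l] removes an extra [y i ^+ e]; times [y i ^+ b] it is the
   collision term with head [b + e]. *)
rewrite -big_distrr /= exprD; ring.
Qed.

Lemma mdsum_elim e a :
  mdsum (e :: a) [::] =
  mdsum a [::] * pows e - \sum_(c <- addone e a) mdsum c [::].
Proof. by rewrite mdsum_rcons_head mdsum_rcons big_nil subr0. Qed.

(** A zero exponent makes every collision leave [a] unchanged, and [pows 0] is [n]. *)
Lemma mdsum_elim0 a :
  mdsum (0%N :: a) [::] = (n%:R - (size a)%:R) * mdsum a [::].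
Proof.
rewrite mdsum_elim mulrBl; congr (_ - _).
  by rewrite /pows sumr_const card_ord mulrC.
suff -> : addone 0 a = nseq (size a) a.
  by rewrite big_nseq iter_addr_0 mulr_natl.
elim: a => //= b a ->; rewrite addn0; congr (_ :: _).
by rewrite map_nseq.
Qed.

Lemma mdsum_sort a : mdsum a [::] = mdsum (sort leq a) [::].
Proof. by apply: perm_mdsum; rewrite perm_sym perm_sort. Qed.

(** Exactly one of the six orderings of a distinct triple is increasing, and the two transpositions
    in the hypotheses generate all permutations. *)
Lemma sum3_sorted (f : 'I_n -> 'I_n -> 'I_n -> A) :
  (forall i j k, f i j k = f j i k) -> (forall i j k, f i j k = f i k j) ->
  \sum_i \sum_j \sum_k (uniq [:: k; j; i])%:R * f i j k =
  6 * \sum_(i < n) \sum_(j < n | (i < j)%N) \sum_(k < n | (j < k)%N) f i j k.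
Proof.
move=> f12 f23.
pose g (i j k : 'I_n) : A := ((i < j < k)%N)%:R * f i j k.
have -> : \sum_(i < n) \sum_(j < n | (i < j)%N) \sum_(k < n | (j < k)%N) f i j k =
    \sum_i \sum_j \sum_k g i j k.
  apply: eq_bigr => i _; rewrite big_mkcond; apply: eq_bigr => j _ /=.
  rewrite big_mkcond /g; case: ifP => _; last first.
    by rewrite big1 // => k _; rewrite mul0r.
  by apply: eq_bigr => k _; case: ifP; rewrite /= ?mul1r ?mul0r.
have E (i j k : 'I_n) : (uniq [:: k; j; i])%:R * f i j k =
    g i j k + g i k j + g j i k + g j k i + g k i j + g k j i.
  rewrite /g (f23 i k j) (f12 j i k) (f23 j k i) (f12 j i k) (f12 k i j)
    (f23 i k j) (f12 k j i) (f23 j k i) (f12 j i k) -!mulrDl; congr (_ * _).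
  rewrite /= !inE andbT negb_or -!(inj_eq val_inj) /=.
  by case: (ltngtP i j); case: (ltngtP j k); case: (ltngtP i k) => //=;
    rewrite ?addr0 ?add0r //; lia.
transitivity (\sum_i \sum_j \sum_k
   (g i j k + g i k j + g j i k + g j k i + g k i j + g k j i)).
  by do 3![apply: eq_bigr => ? _]; exact: E.
under eq_bigr => i _.
  under eq_bigr => j _ do rewrite !big_split /=.
  rewrite !big_split /=; over.
rewrite !big_split /=.
set S := \sum_i \sum_j \sum_k g i j k.
have S2 : \sum_i \sum_j \sum_k g i k j = S.
  by apply: eq_bigr => i _; rewrite exchange_big.
have S3 : \sum_i \sum_j \sum_k g j i k = S by rewrite exchange_big.
have S4 : \sum_i \sum_j \sum_k g j k i = S.
  rewrite -S2 exchange_big; apply: eq_bigr => i _; exact: eq_bigr.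
have S5 : \sum_i \sum_j \sum_k g k i j = S.
  by under eq_bigr => i _ do rewrite exchange_big; rewrite S3.
have S6 : \sum_i \sum_j \sum_k g k j i = S.
  by under eq_bigr => i _ do rewrite exchange_big; rewrite S4.
rewrite S2 S3 S4 S5 S6; ring.
Qed.

End DistinctSums.

(** * Degree-six monomial sums when the first power sum vanishes *)

Section Degree6.

Variables (A : comNzRingType) (n : nat) (y : 'I_n -> A).
Hypothesis y0 : \sum_i y i = 0.

Local Notation p := (pows y).
Local Notation M a := (mdsum y a [::]).

(** All eleven partitions of 6, as sorted lists, bundled into one rewriting rule. Eliminating a
    leading 1 leaves only collision terms, since [p 1 = 0], so each entry follows from shorter
    ones. *)
Lemma mdsum_deg6 :
  (M [:: 6] = p 6)
  * (M [:: 2; 4] = p 2 * p 4 - p 6)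
  * (M [:: 3; 3] = p 3 ^+ 2 - p 6)
  * (M [:: 1; 5] = - p 6)
  * (M [:: 1; 1; 4] = 2 * p 6 - p 2 * p 4)
  * (M [:: 1; 2; 3] = 2 * p 6 - p 2 * p 4 - p 3 ^+ 2)
  * (M [:: 2; 2; 2] = p 2 ^+ 3 - 3 * (p 2 * p 4) + 2 * p 6)
  * (M [:: 1; 1; 1; 3] = 3 * (p 2 * p 4) + 2 * p 3 ^+ 2 - 6 * p 6)
  * (M [:: 1; 1; 2; 2] =
      5 * (p 2 * p 4) + 2 * p 3 ^+ 2 - p 2 ^+ 3 - 6 * p 6)
  * (M [:: 1; 1; 1; 1; 2] =
      3 * p 2 ^+ 3 - 18 * (p 2 * p 4) - 8 * p 3 ^+ 2 + 24 * p 6)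
  * (M [:: 1; 1; 1; 1; 1; 1] =
      90 * (p 2 * p 4) + 40 * p 3 ^+ 2 - 15 * p 2 ^+ 3 - 120 * p 6).
Proof.
have p1 : p 1 = 0 by rewrite -[RHS]y0; apply: eq_bigr => i _; rewrite expr1.
have M0 : M [::] = 1 by rewrite /mdsum /= mulr1.
have M1 e : M [:: e] = p e by rewrite mdsum_elim M0 /= big_nil subr0 mul1r.
have M24 : M [:: 2; 4] = p 2 * p 4 - p 6.
  by rewrite mdsum_elim /= !big_cons big_nil !M1; ring.
have M33 : M [:: 3; 3] = p 3 ^+ 2 - p 6.
  by rewrite mdsum_elim /= !big_cons big_nil !M1; ring.
have M15 : M [:: 1; 5] = - p 6.
  by rewrite mdsum_elim /= !big_cons big_nil !M1 p1; ring.
pose srt a : M a = M (sort leq a) := mdsum_sort y a.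
have M114 : M [:: 1; 1; 4] = 2 * p 6 - p 2 * p 4.
  by rewrite mdsum_elim /= !big_cons big_nil M24 M15 p1; ring.
have M123 : M [:: 1; 2; 3] = 2 * p 6 - p 2 * p 4 - p 3 ^+ 2.
  by rewrite mdsum_elim /= !big_cons big_nil M33 M24 p1; ring.
have M222 : M [:: 2; 2; 2] = p 2 ^+ 3 - 3 * (p 2 * p 4) + 2 * p 6.
  by rewrite 2!mdsum_elim /= !big_cons !big_nil (srt [:: 4; 2]) M24 !M1; ring.
have M1113 : M [:: 1; 1; 1; 3] = 3 * (p 2 * p 4) + 2 * p 3 ^+ 2 - 6 * p 6.
  rewrite mdsum_elim /= !big_cons big_nil (srt [:: 2; 1; 3]).
  by rewrite [sort _ _]/= M123 M114 p1; ring.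
have M1122 : M [:: 1; 1; 2; 2] =
    5 * (p 2 * p 4) + 2 * p 3 ^+ 2 - p 2 ^+ 3 - 6 * p 6.
  rewrite mdsum_elim /= !big_cons big_nil (srt [:: 1; 3; 2]).
  by rewrite [sort _ _]/= M222 M123 p1; ring.
have M11112 : M [:: 1; 1; 1; 1; 2] =
    3 * p 2 ^+ 3 - 18 * (p 2 * p 4) - 8 * p 3 ^+ 2 + 24 * p 6.
  rewrite mdsum_elim /= !big_cons big_nil.
  rewrite (srt [:: 2; 1; 1; 2]) (srt [:: 1; 2; 1; 2]).
  by rewrite ![sort _ _]/= M1122 M1113 p1; ring.
have M111111 : M [:: 1; 1; 1; 1; 1; 1] =
    90 * (p 2 * p 4) + 40 * p 3 ^+ 2 - 15 * p 2 ^+ 3 - 120 * p 6.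
  rewrite mdsum_elim /= !big_cons big_nil.
  rewrite (srt [:: 2; 1; 1; 1; 1]) (srt [:: 1; 2; 1; 1; 1])
    (srt [:: 1; 1; 2; 1; 1]) (srt [:: 1; 1; 1; 2; 1]).
  by rewrite ![sort _ _]/= M11112 p1; ring.
by rewrite M1 M24 M33 M15 M114 M123 M222 M1113 M1122 M11112 M111111.
Qed.


(** * Expansion of products of three squared differences *)

Local Notation N := (n%:R : A).

Definition sq_terms : seq (A * (nat * nat)) :=
  [:: (1, (2, 0)%N); (-2, (1, 1)%N); (1, (0, 2)%N)].

Lemma sqrB_terms (u v : A) :
  (u - v) ^+ 2 = \sum_(m <- sq_terms) m.1 * (u ^+ m.2.1 * v ^+ m.2.2).
Proof. rewrite !big_cons big_nil /=; ring. Qed.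

(** The map [E] records which factors share an index: it turns the exponent pairs of the three
    squares into one exponent per index. *)
Definition sq3_terms (E : nat * nat -> nat * nat -> nat * nat -> seq nat) :
    seq (A * seq nat) :=
  [seq (a.1 * b.1.1 * b.2.1, E a.2 b.1.2 b.2.2) |
     a <- sq_terms, b <- [seq (b, c) | b <- sq_terms, c <- sq_terms]].

Lemma sq3_termsE E (u1 v1 u2 v2 u3 v3 : A) (f : seq nat -> A) :
  (forall a b c, f (E a b c) = u1 ^+ a.1 * v1 ^+ a.2 *
    (u2 ^+ b.1 * v2 ^+ b.2) * (u3 ^+ c.1 * v3 ^+ c.2)) ->
  (u1 - v1) ^+ 2 * (u2 - v2) ^+ 2 * (u3 - v3) ^+ 2 =
  \sum_(t <- sq3_terms E) t.1 * f t.2.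
Proof.
move=> fE; rewrite !sqrB_terms (@big_allpairs_dep _ _ _ _ (fun=> _)) -mulrA
  big_distrl.
apply: eq_bigr => a _.
rewrite (@big_allpairs_dep _ _ _ _ (fun=> _)) big_distrl big_distrr /=.
apply: eq_bigr => b _; rewrite !big_distrr /=.
by apply: eq_bigr => c _; rewrite fE; ring.
Qed.

Lemma sum_mdsum_sort (r : seq (A * seq nat)) :
  \sum_(t <- r) t.1 * M t.2 = \sum_(t <- r) t.1 * M (sort leq t.2).
Proof. by apply: eq_bigr => t _; rewrite -mdsum_sort. Qed.

(** Sorting brings zero exponents to the front, where [mdsum_elim0] strips them; a partition of 6
    remains. *)
Ltac eval_mdsum :=
  rewrite sum_mdsum_sort !big_cons big_nil; cbn [fst snd];
  rewrite ![sort _ _]/= !mdsum_elim0 !mdsum_deg6 ![size _]/=; ring.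

(** By Cauchy-Binet the right side is 6 times the Hankel determinant of [N, p 1, p 2, p 3, p 4] at
    [p 1 = 0]; here it is obtained by direct expansion. *)
Lemma Tsum_pows :
  \sum_i \sum_j \sum_k (uniq [:: k; j; i])%:R *
    ((y i - y j) ^+ 2 * (y j - y k) ^+ 2 * (y k - y i) ^+ 2) =
  6 * (N * (p 2 * p 4) - p 2 ^+ 3 - N * p 3 ^+ 2).
Proof.
pose E (a b c : nat * nat) := [:: a.1 + c.2; a.2 + b.1; b.2 + c.1]%N.
transitivity (\sum_(t <- sq3_terms E) t.1 * M t.2); last by eval_mdsum.
transitivity (distsum 3 [::] (fun v =>
    \sum_(t <- sq3_terms E) t.1 * monom y t.2 v)).
  apply: eq_bigr => i _; apply: eq_bigr => j _; apply: eq_bigr => k _;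
  congr (_ * _); apply: (sq3_termsE (f := monom y ^~ [:: i; j; k])) => a b c.
  by rewrite /= !exprD; ring.
(* Once the 27 terms are explicit, each exponent list has computed length 3, and [M] agrees with
   [distsum 3] by conversion. *)
by rewrite distsum_sum /sq3_terms !big_cons !big_nil.
Qed.

Lemma Usum_pows :
  \sum_i \sum_j \sum_k \sum_l \sum_m (uniq [:: m; l; k; j; i])%:R *
    ((y i - y j) ^+ 2 * (y j - y k) ^+ 2 * (y l - y m) ^+ 2) =
  (N - 4) * (6 * (N - 2) * p 2 ^+ 3 + 4 * (2 * N - 5) * p 3 ^+ 2
             + 2 * (N ^+ 2 - 9 * N + 15) * (p 2 * p 4)
             - 2 * N * (N - 1) * p 6).
Proof.
pose E (a b c : nat * nat) := [:: a.1; a.2 + b.1; b.2; c.1; c.2]%N.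
transitivity (\sum_(t <- sq3_terms E) t.1 * M t.2); last by eval_mdsum.
transitivity (distsum 5 [::] (fun v =>
    \sum_(t <- sq3_terms E) t.1 * monom y t.2 v)).
  apply: eq_bigr => i _; apply: eq_bigr => j _; apply: eq_bigr => k _;
  apply: eq_bigr => l _; apply: eq_bigr => m _;
  congr (_ * _); apply: (sq3_termsE (f := monom y ^~ [:: i; j; k; l; m])) => a b c.
  by rewrite /= !exprD; ring.
by rewrite distsum_sum /sq3_terms !big_cons !big_nil.
Qed.

Lemma Rsum_pows :
  \sum_i \sum_j \sum_k \sum_l \sum_m \sum_s (uniq [:: s; m; l; k; j; i])%:R *
    ((y i - y j) ^+ 2 * (y k - y l) ^+ 2 * (y m - y s) ^+ 2) =
  8 * (N - 2) * (N ^+ 2 - 7 * N + 15) * p 2 ^+ 3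
  - 16 * (3 * N ^+ 2 - 15 * N + 20) * p 3 ^+ 2
  - 24 * (N - 2) * (N ^+ 2 - 5 * N + 10) * (p 2 * p 4)
  + 16 * N * (N - 1) * (N - 2) * p 6.
Proof.
pose E (a b c : nat * nat) := [:: a.1; a.2; b.1; b.2; c.1; c.2]%N.
transitivity (\sum_(t <- sq3_terms E) t.1 * M t.2); last by eval_mdsum.
transitivity (distsum 6 [::] (fun v =>
    \sum_(t <- sq3_terms E) t.1 * monom y t.2 v)).
  apply: eq_bigr => i _; apply: eq_bigr => j _; apply: eq_bigr => k _;
  apply: eq_bigr => l _; apply: eq_bigr => m _; apply: eq_bigr => s _;
  congr (_ * _); apply: (sq3_termsE (f := monom y ^~ [:: i; j; k; l; m; s])) => a b c.
  by rewrite /=; ring.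
by rewrite distsum_sum /sq3_terms !big_cons !big_nil.
Qed.

End Degree6.

(** * Centred indeterminates and comparison of coefficients *)

Lemma sum_z (F : numFieldType) (n : nat) : (0 < n)%N -> \sum_i z F (n:=n) i = 0.
Proof.
move=> n0; rewrite /z sumrB sumr_const card_ord /xbar -scaler_nat scalerA.
by rewrite divff ?pnatr_eq0 -?lt0n // scale1r subrr.
Qed.

(** The distinctness condition becomes a 0/1 factor, with the list reversed because [distsum]
    accumulates indices at the front. *)
Lemma Usum_uniq (F : fieldType) (n : nat) :
  Usum F n = \sum_i \sum_j \sum_k \sum_l \sum_m
    (uniq [:: m; l; k; j; i])%:R * (sqdiff F i j * sqdiff F j k * sqdiff F l m).
Proof.
apply: eq_bigr => i _; apply: eq_bigr => j _; apply: eq_bigr => k _.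
apply: eq_bigr => l _; rewrite big_mkcond; apply: eq_bigr => m _.
by rewrite -(rev_uniq [:: m; l; k; j; i]) mulr_natl mulrb.
Qed.

Lemma Rsum_uniq (F : fieldType) (n : nat) :
  Rsum F n = \sum_i \sum_j \sum_k \sum_l \sum_m \sum_s
    (uniq [:: s; m; l; k; j; i])%:R *
    (sqdiff F i j * sqdiff F k l * sqdiff F m s).
Proof.
apply: eq_bigr => i _; apply: eq_bigr => j _; apply: eq_bigr => k _.
apply: eq_bigr => l _; apply: eq_bigr => m _; rewrite big_mkcond.
apply: eq_bigr => s _.
by rewrite -(rev_uniq [:: s; m; l; k; j; i]) mulr_natl mulrb.
Qed.

Theorem theorem22 (F : numFieldType) (n : nat) (hn : (5 <= n)%N) :
  psum F n 2 ^+ 3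
    - (n%:R * (n%:R - 1) / (n%:R - 2) ^+ 2 : F) *: psum F n 3 ^+ 2
  = ((n%:R + 3) / (n%:R * (n%:R - 2)) : F) *: Tsum F n
    + (1 / (n%:R * (n%:R - 2) * (n%:R - 4)) : F) *: Usum F n
    + (1 / (8 * n%:R * (n%:R - 2) ^+ 2) : F) *: Rsum F n
  /\ [/\ 0 < (n%:R + 3) / (n%:R * (n%:R - 2)) :> F,
         0 < 1 / (n%:R * (n%:R - 2) * (n%:R - 4)) :> F
       & 0 < 1 / (8 * n%:R * (n%:R - 2) ^+ 2) :> F].
Proof.
have gt_n k : (k < 5)%N -> 0 < n%:R - k%:R :> F.
  by move=> k5; rewrite subr_gt0 ltr_nat (leq_trans k5).
have n0 : 0 < n%:R :> F by rewrite -[n%:R]subr0; apply: (gt_n 0).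
have n2 : 0 < n%:R - 2 :> F by apply: gt_n.
have n4 : 0 < n%:R - 4 :> F by apply: gt_n.
split; last first.
  split; apply: divr_gt0 => //; first exact: addr_gt0.
  - exact: mulr_gt0.
  - by rewrite !mulr_gt0.
  - by rewrite !mulr_gt0 ?exprn_gt0.
have z0 : \sum_i z F (n:=n) i = 0 by apply: sum_z; apply: leq_trans hn.
have pE r : pows (z F (n:=n)) r = psum F n r by [].
have T_eq : Tsum F n = n%:R * (psum F n 2 * psum F n 4) - psum F n 2 ^+ 3
    - n%:R * psum F n 3 ^+ 2.
  (* The ordered sum is 6 times [Tsum], and 6 can be cancelled in characteristic zero. *)
  have six0 : (6 : F) != 0 by rewrite pnatr_eq0.
  apply: (scalerI six0); rewrite !scaler_nat -[LHS]mulr_natl -[RHS]mulr_natl.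
  rewrite -!pE -(Tsum_pows z0) (sum3_sorted (f := fun i j k =>
    sqdiff F i j * sqdiff F j k * sqdiff F k i)) // => i j k;
  rewrite /sqdiff; move: (z F i) (z F j) (z F k) => u v w; ring.
have U_eq := etrans (Usum_uniq F n) (Usum_pows z0).
have R_eq := etrans (Rsum_uniq F n) (Rsum_pows z0).
rewrite !pE in U_eq R_eq.
set c1 := (X in X *: psum F n 3 ^+ 2); set c2 := (X in X *: Tsum F n).
set c3 := (X in X *: Usum F n); set c4 := (X in X *: Rsum F n).
(* A common multiple of the four denominators, nonzero because [n] is at least 5. *)
pose D : F := 8 * n%:R * (n%:R - 2) ^+ 2 * (n%:R - 4).
have D0 : D != 0 by rewrite gt_eqF // !mulr_gt0 ?exprn_gt0.
have E1 : D * c1 = 8 * n%:R ^+ 2 * (n%:R - 1) * (n%:R - 4).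
  by rewrite /D /c1; field; rewrite gt_eqF.
have E2 : D * c2 = 8 * (n%:R - 2) * (n%:R - 4) * (n%:R + 3).
  by rewrite /D /c2; field; rewrite !gt_eqF.
have E3 : D * c3 = 8 * (n%:R - 2).
  by rewrite /D /c3; field; rewrite !gt_eqF.
have E4 : D * c4 = n%:R - 4.
  by rewrite /D /c4; field; rewrite !gt_eqF.
apply: (scalerI D0); rewrite scalerBr !scalerDr !scalerA E1 E2 E3 E4 /D.
rewrite -![_ *: _]mul_mpolyC.
rewrite !(rmorphM, rmorphB, rmorphD, rmorphXn, rmorph_nat, rmorph1) /=.
rewrite T_eq U_eq R_eq.
(* With denominators cleared, the identity holds for arbitrary values of [n] and the power sums; the
   terms in [p2 * p4] and [p6] cancel. *)
move: (psum F n 2) (psum F n 3) (psum F n 4) (psum F n 6) (n%:R : {mpoly F[n]}).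
move=> p2 p3 p4 p6 N; ring.
Qed.
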